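(* Let $m\ge n\ge 2$ and let $h(\mathbf x,\mathbf y,z)=h_0z^4+h_1(\mathbf x,\mathbf y)z^3+h_2(\mathbf x,\mathbf y)z^2+h_3(\mathbf x,\mathbf y)z+h_4(\mathbf x,\mathbf y)$ be a tripartite quartic polynomial with $\mathbf x\in\mathbb R^{m-1}$, $\mathbf y\in\mathbb R^{n-1}$, $z\in\mathbb R$. If $h$ is PSD, then $h_0\ge 0$ and $h_4(\mathbf x,\mathbf y)$ is PSD. Furthermore, if $h_0=0$, then $h$ is PSD if and only if (i) $h_1(\mathbf x,\mathbf y)\equiv 0$, and (ii) $h_2(\mathbf x,\mathbf y)$, $h_4(\mathbf x,\mathbf y)$ and $4h_2(\mathbf x,\mathbf y)h_4(\mathbf x,\mathbf y)-h_3(\mathbf x,\mathbf y)^2$ are PSD.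
   Context: A real polynomial is PSD (positive semi-definite) if it takes nonnegative values at all real points. A tripartite quartic polynomial $h(\mathbf x,\mathbf y,z)$ is a real homogeneous polynomial of degree $4$ such that in every term the total degree in the $x$-variables is at most $2$ and the total degree in the $y$-variables is at most $2$. In the expansion in powers of $z$: $h_0$ is a constant; $h_1$ is a linear form in $(\mathbf x,\mathbf y)$; $h_2$ is the sum of a quadratic form in $\mathbf x$, a quadratic form in $\mathbf y$ and a bilinear form in $(\mathbf x,\mathbf y)$; $h_3$ is the sum of a form of bidegree $(1,2)$ and a form of bidegree $(2,1)$ in $(\mathbf x,\mathbf y)$; $h_4$ is an $(m-1)\times(n-1)$ biquadratic polynomial (bidegree $(2,2)$). *)

(* Defs.v *)
From mathcomp Require Import all_boot all_order all_algebra.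
From mathcomp Require Import mpoly.
From mathcomp Require Import reals.

Set Implicit Arguments.
Unset Strict Implicit.
Unset Printing Implicit Defensive.

Import GRing.Theory Num.Theory.
Local Open Scope ring_scope.

(* Real polynomials in [(p + q).+1] variables: the first [p] variables are the
   x-variables, the next [q] are the y-variables and the last one is z.  A
   polynomial in [p + q] variables is one in (x, y) only; [mwiden] views it as
   a polynomial in (x, y, z), the new variable z having index [ord_max]. *)

Definition psd (R : realType) (k : nat) (f : {mpoly R[k]}) : Prop :=
  forall v : 'I_k -> R, 0 <= f.@[v].

Definition xdeg (p q : nat) (a : 'X_{1..(p + q).+1}) : nat :=
  (\sum_(i < p) a (widen_ord (leqnSn (p + q)) (lshift q i)))%N.

Definition ydeg (p q : nat) (a : 'X_{1..(p + q).+1}) : nat :=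
  (\sum_(j < q) a (widen_ord (leqnSn (p + q)) (rshift p j)))%N.

Definition tripartite_quartic (R : realType) (p q : nat)
    (h : {mpoly R[(p + q).+1]}) : Prop :=
  h \is 4.-homog /\
  (forall a : 'X_{1..(p + q).+1}, a \in msupp h -> (xdeg a <= 2)%N /\ (ydeg a <= 2)%N).

(* Main.v *)
(** For fixed (x, y) the polynomial h is a quartic in z.  Letting z grow, and
    putting z = 0, gives the first claim.  If h_0 = 0, it is a cubic in z, which
    is nonnegative on the whole line only if its leading coefficient h_1(x, y)
    vanishes; the rest is the discriminant criterion for the quadratic
    h_2 z^2 + h_3 z + h_4, and h_1 vanishing at all points is the zero
    polynomial. *)
Require Import Defs.
From mathcomp Require Import all_boot all_order all_algebra.
From mathcomp Require Import mpoly.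
From mathcomp Require Import reals.
From mathcomp Require Import ring lra.

Set Implicit Arguments.
Unset Strict Implicit.
Unset Printing Implicit Defensive.

Import Order.TTheory GRing.Theory Num.Theory.
Local Open Scope ring_scope.

(** The numerals [0, 1, ..., size p - 1] are distinct in characteristic zero, and a nonzero [p] has
    fewer than [size p] roots. *)
Lemma poly_eq0_horner (R : numDomainType) (p : {poly R}) :
  (forall x, p.[x] = 0) -> p = 0.
Proof.
move=> p0; apply: (@roots_geq_poly_eq0 _ p [seq i%:R | i <- iota 0 (size p)]).
- by apply/allP => x _; rewrite rootE p0.
- rewrite map_inj_uniq ?iota_uniq // => i j /eqP.
  by rewrite eqr_nat => /eqP.
- by rewrite size_map size_iota.
Qed.

(** The new coordinate sits at [ord_max], the index that [mwiden] and [muni] reserve for the last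
    variable. *)
Definition extend (R : Type) (k : nat) (v : 'I_k -> R) (z : R) (i : 'I_k.+1) : R :=
  if unlift ord_max i is Some j then v j else z.

Lemma extend_max (R : Type) k (v : 'I_k -> R) z : extend v z ord_max = z.
Proof. by rewrite /extend unlift_none. Qed.

Lemma extend_widen (R : Type) k (v : 'I_k -> R) z i :
  extend v z (widen_ord (leqnSn k) i) = v i.
Proof.
have -> : widen_ord (leqnSn k) i = lift ord_max i.
  by apply: val_inj; rewrite /= /bump leqNgt ltn_ord.
by rewrite /extend liftK.
Qed.

Lemma meval_mwiden (R : comNzRingType) k (p : {mpoly R[k]}) v z :
  (mwiden p).@[extend v z] = p.@[v].
Proof.
rewrite (mwidenE (leqnn _)) [in RHS](mpolywE (leqnn (msize p))) !raddf_sum.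
apply: eq_bigr => m _; rewrite /= !mevalZ !mevalX big_ord_recr /=.
rewrite mnmwiden_ordmax expr0 mulr1; congr (_ * _).
by apply: eq_bigr => i _; rewrite mnmwiden_widen extend_widen.
Qed.

Lemma muni_meval (R : comNzRingType) k (p : {mpoly R[k.+1]}) v z :
  (map_poly (meval v) (muni p)).[z] = p.@[extend v z].
Proof.
rewrite muniE mevalE raddf_sum horner_sum; apply: eq_bigr => m _.
rewrite /= map_polyZ map_polyXn hornerZ hornerXn /= mevalZ mevalX -mulrA.
rewrite big_ord_recr /= extend_max; congr (_ * (_ * _)).
by apply: eq_bigr => i _; rewrite mnmE extend_widen.
Qed.

(** This lets the vanishing of all coefficients in the last variable be carried back to [p]
    itself. *)
Lemma muniK (R : comNzRingType) k (p : {mpoly R[k.+1]}) :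
  (map_poly (@mwiden k R) (muni p)).['X_ord_max] = p.
Proof.
rewrite muniE [RHS]mpolyE raddf_sum horner_sum; apply: eq_bigr => m _.
rewrite /= map_polyZ map_polyXn hornerZ hornerXn /= mwidenZ mwidenX -scalerAl.
congr (_ *: _); rewrite [RHS]mpolyXE_id big_ord_recr /= mpolyXE_id; congr (_ * _).
rewrite big_ord_recr /= mnmwiden_ordmax expr0 mulr1.
by apply: eq_bigr => i _; rewrite mnmwiden_widen mnmE.
Qed.

(** Induction on the number of variables, with [p] read as a univariate polynomial in the last one
    over polynomials in the others. *)
Lemma mpoly_eq0_meval (R : numDomainType) k (p : {mpoly R[k]}) :
  (forall v, p.@[v] = 0) -> p = 0.
Proof.
elim: k p => [|k IHk] p p0.
  have M0 (m : 'X_{1..0}) : m = 0%MM by apply/mnmP; case.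
  apply/mpolyP => m; rewrite (M0 m) mcoeff0 -[RHS](p0 (fun=> 0)).
  rewrite [in LHS](mpolyE p) mevalE raddf_sum; apply: eq_bigr => a _ /=.
  by rewrite big_ord0 mcoeffZ mcoeffX (M0 a) eqxx.
suff m0 : muni p = 0 by rewrite -(muniK p) m0 raddf0 horner0.
apply/polyP => i; rewrite coef0.
(* With [v] fixed, the value of this coefficient is a coefficient of a univariate polynomial
   vanishing at every [z]. *)
apply: IHk => v; rewrite -[LHS](coef_map (meval v)).
by rewrite (poly_eq0_horner (p := map_poly _ _)) ?coef0 // => z; rewrite muni_meval.
Qed.

Lemma ler_monomial (R : realDomainType) (a z : R) (i k : nat) :
  1 <= z -> (i <= k)%N -> a * z ^+ i <= `|a| * z ^+ k.
Proof.
move=> z1 ik; have z0 : 0 <= z := le_trans ler01 z1.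
apply: le_trans (ler_wpM2r (exprn_ge0 _ z0) (ler_norm a)) _.
by apply: ler_wpM2l; rewrite // ler_weXn2l.
Qed.

Lemma lead_ge0 (R : realFieldType) (k : nat) (a S : R) (r : R -> R) :
    (forall z, 1 <= z -> r z <= S * z ^+ k) ->
    (forall z, 1 <= z -> 0 <= a * z ^+ k.+1 + r z) ->
  0 <= a.
Proof.
move=> rS pos; rewrite leNgt; apply/negP => a0.
(* The point [t] is chosen so that [a * t = a - |S|]; then [a * t + S <= a < 0], and the factor
   [t ^+ k] keeps the sign. *)
have t1 : 1 <= 1 + `|S| / - a by rewrite lerDl divr_ge0 // oppr_ge0 ltW.
set t := 1 + _ in t1; have t0 : 0 < t ^+ k by rewrite exprn_gt0 // (lt_le_trans ltr01).
suff: a * t ^+ k.+1 + r t < 0 by rewrite ltNge pos.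
apply: le_lt_trans (lerD (lexx _) (rS _ t1)) _.
rewrite exprS mulrA -mulrDl pmulr_llt0 //.
have -> : a * t = a - `|S|.
  by rewrite /t; field; rewrite lt_eqF.
have := ler_norm S; lra.
Qed.

Lemma quartic_lead_ge0 (R : realFieldType) (e a b c d : R) :
    (forall z, 1 <= z ->
      0 <= e * z ^+ 4 + a * z ^+ 3 + b * z ^+ 2 + c * z + d) ->
  0 <= e.
Proof.
(* The exponents 1 and 0 are kept explicit so that [ler_monomial] bounds each lower term by a
   multiple of [z ^+ 3]. *)
move=> pos; apply: (@lead_ge0 _ 3 _ (`|a| + `|b| + `|c| + `|d|)
  (fun z => a * z ^+ 3 + b * z ^+ 2 + c * z ^+ 1 + d * z ^+ 0)) => z z1.
  by rewrite !mulrDl !lerD ?ler_monomial.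
by have := pos z z1; congr (0 <= _); ring.
Qed.

Lemma cubic_lead_ge0 (R : realFieldType) (a b c d : R) :
  (forall z, 1 <= z -> 0 <= a * z ^+ 3 + b * z ^+ 2 + c * z + d) -> 0 <= a.
Proof.
(* Multiplying by [z >= 1] raises the degree by one and keeps the sign. *)
move=> pos; apply: (@quartic_lead_ge0 _ a b c d 0) => z z1.
have := mulr_ge0 (le_trans ler01 z1) (pos z z1).
by congr (0 <= _); ring.
Qed.

Lemma cubic_ge0_lead_eq0 (R : realFieldType) (a b c d : R) :
  (forall z, 0 <= a * z ^+ 3 + b * z ^+ 2 + c * z + d) -> a = 0.
Proof.
move=> pos; apply/eqP; rewrite eq_le; apply/andP; split.
  (* Substituting [- z] flips the sign of the leading coefficient. *)
  rewrite -oppr_ge0; apply: (@cubic_lead_ge0 _ _ b (- c) d) => z _.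
  by have := pos (- z); congr (0 <= _); ring.
by apply: (@cubic_lead_ge0 _ _ b c d).
Qed.

Lemma quadratic_ge0P (R : realFieldType) (b c d : R) :
  (forall z, 0 <= b * z ^+ 2 + c * z + d) <->
  [/\ 0 <= b, 0 <= d & 0 <= 4%:R * b * d - c ^+ 2].
Proof.
split=> [pos | [b0 d0 disc] z].
  have d0 : 0 <= d by have := pos 0; rewrite expr0n /= !mulr0 !add0r.
  have b0 : 0 <= b.
    apply: (@cubic_lead_ge0 _ b c d 0) => z z1.
    have := mulr_ge0 (le_trans ler01 z1) (pos z).
    by congr (0 <= _); ring.
  split=> //; have [b_eq0 | bn0] := eqVneq b 0; last first.
    (* At the vertex, [4 * b] times the quadratic equals [4 * b * d - c ^+ 2]. *)
    have := mulr_ge0 (mulr_ge0 (ler0n R 4) b0) (pos (- c / (2%:R * b))).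
    by congr (0 <= _); field; rewrite bn0.
  have [-> | cn0] := eqVneq c 0; first by rewrite b_eq0; lra.
  (* For [b = 0] and [c] nonzero, this is where the affine function takes the value -1. *)
  have := pos (- (d + 1) / c); rewrite b_eq0 mul0r add0r.
  have -> : c * (- (d + 1) / c) + d = - 1 by field.
  by rewrite lerNr oppr0 ler10.
have [b_eq0 | bn0] := eqVneq b 0.
  have /eqP : c ^+ 2 = 0.
    apply/eqP; rewrite eq_le sqr_ge0 andbT.
    by move: disc; rewrite b_eq0; lra.
  by rewrite sqrf_eq0 => /eqP ->; rewrite b_eq0 !mul0r !add0r.
have b4 : 0 < 4%:R * b by rewrite mulr_gt0 ?ltr0n // lt_def bn0.
rewrite -(pmulr_rge0 _ b4).
(* Completing the square. *)
have -> : 4%:R * b * (b * z ^+ 2 + c * z + d) =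
  (2%:R * b * z + c) ^+ 2 + (4%:R * b * d - c ^+ 2) by ring.
by rewrite addr_ge0 ?sqr_ge0.
Qed.

Lemma psd_extend (R : realType) k (f : {mpoly R[k.+1]}) :
  psd f <-> forall v z, 0 <= f.@[extend v z].
Proof.
split=> [f0 v z | f0 w]; first exact: f0.
have := f0 (fun i => w (widen_ord (leqnSn k) i)) (w ord_max).
congr (0 <= _); apply: meval_eq => i; rewrite /extend.
case: unliftP => [j|] -> //; congr w.
by apply: val_inj; rewrite /= /bump leqNgt ltn_ord.
Qed.

Theorem theorem2p3 (R : realType) (m n : nat) (hn : (2 <= n)%N) (hmn : (n <= m)%N)
    (h : {mpoly R[(m.-1 + n.-1).+1]})
    (h0 : R) (h1 h2 h3 h4 : {mpoly R[m.-1 + n.-1]})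
    (hE : h = h0 *: 'X_ord_max ^+ 4 + mwiden h1 * 'X_ord_max ^+ 3
            + mwiden h2 * 'X_ord_max ^+ 2 + mwiden h3 * 'X_ord_max + mwiden h4)
    (htri : tripartite_quartic h) :
  (psd h -> 0 <= h0 /\ psd h4) /\
  (h0 = 0 ->
     (psd h <->
        h1 = 0 /\
        (psd h2 /\ psd h4 /\ psd (4%:R * h2 * h4 - h3 ^+ 2)))).
Proof.
have hvz v z : h.@[extend v z] =
    h0 * z ^+ 4 + h1.@[v] * z ^+ 3 + h2.@[v] * z ^+ 2 + h3.@[v] * z + h4.@[v].
  have zX e : ('X_ord_max ^+ e : {mpoly R[_]}).@[extend v z] = z ^+ e.
    by rewrite (rmorphXn (meval _)) /= mevalXU extend_max.
  rewrite hE !mevalD mevalZ !(mevalM _ (mwiden _)) !zX !meval_mwiden.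
  by rewrite mevalXU extend_max.
have discE v : (4%:R * h2 * h4 - h3 ^+ 2).@[v] =
    4%:R * h2.@[v] * h4.@[v] - h3.@[v] ^+ 2.
  by rewrite mevalB (rmorphXn (meval v)) !mevalM (rmorph_nat (meval v)).
split=> [/psd_extend pos | h0E].
  split=> [|v]; last by have := pos v 0; rewrite hvz !expr0n /= !mulr0 !add0r.
  (* Since [h0] does not depend on (x, y), one point suffices; the origin is taken. *)
  pose v (i : 'I_(m.-1 + n.-1)) : R := 0.
  by apply: (@quartic_lead_ge0 _ _ h1.@[v] h2.@[v] h3.@[v] h4.@[v]) => z _; rewrite -hvz.
(* Both directions of the equivalence reduce to this case, once [h1 = 0] is assumed or derived. *)
have quadP : h1 = 0 -> psd h <-> psd h2 /\ psd h4 /\ psd (4%:R * h2 * h4 - h3 ^+ 2).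
  move=> h1E.
  have hq v z : h.@[extend v z] = h2.@[v] * z ^+ 2 + h3.@[v] * z + h4.@[v].
    by rewrite hvz h0E h1E meval0 !mul0r !add0r.
  split=> [/psd_extend pos | [p2 [p4 pd]]].
    have q v : [/\ 0 <= h2.@[v], 0 <= h4.@[v]
                & 0 <= (4%:R * h2 * h4 - h3 ^+ 2).@[v]].
      by rewrite discE; apply/quadratic_ge0P => z; rewrite -hq.
    by split; [|split] => v; have [] := q v.
  apply/psd_extend => v z; rewrite hq; move: z.
  by apply/quadratic_ge0P; rewrite -discE; split.
split=> [pos | [h1E] /(quadP h1E) //].
suff h1E : h1 = 0 by split=> //; apply/quadP.
apply: mpoly_eq0_meval => v.
apply: (@cubic_ge0_lead_eq0 _ _ h2.@[v] h3.@[v] h4.@[v]) => z.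
by have := pos (extend v z); rewrite hvz h0E mul0r add0r.
Qed.
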